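(* Let $\Phi:\mathbb{R}\to\mathbb{R}$ be smooth and convex. Then: (1) If $\sigma\in\mathbb{R}$ and $R,V\in C^1(\mathbb{R})\cap L^\infty(\mathbb{R})$ form a front with speed $\sigma$ and asymptotic states $(r_\pm,v_\pm)$, then $(r_\pm,v_\pm)$ and $\sigma$ define a conservative shock of the p-system, i.e. $$\sigma[\![r]\!]+[\![v]\!]=0,\qquad \sigma[\![v]\!]+[\![\Phi'(r)]\!]=0,\qquad \sigma[\![\tfrac12 v^2+\Phi(r)]\!]+[\![\Phi'(r)v]\!]=0 .$$ (2) Conversely, let $(r_-,v_-)\neq(r_+,v_+)$ and $\sigma\in\mathbb{R}$ satisfy the three jump conditions above, suppose the shock is supersonic, i.e. $|\sigma|>\sqrt{\Phi''(r_-)}$ and $|\sigma|>\sqrt{\Phi''(r_+)}$, and suppose the area condition holds: $g(w)>0$ for all $w\in(-1,1)$. Then there exists a front $(R,V)$ with speed $\sigma$ and asymptotic states $(r_\pm,v_\pm)$ whose profiles $R$ and $V$ are monotone.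
   Context: A front with speed $\sigma$ and asymptotic states $(r_\pm,v_\pm)$ is a pair of functions $R,V\in C^1(\mathbb{R})\cap L^\infty(\mathbb{R})$ with $R(\varphi)\to r_\pm$, $V(\varphi)\to v_\pm$ as $\varphi\to\pm\infty$, solving the advance-delay equations $$\sigma R'(\varphi)+V(\varphi+1)-V(\varphi)=0,\qquad \sigma V'(\varphi)+\Phi'(R(\varphi))-\Phi'(R(\varphi-1))=0\quad(\varphi\in\mathbb{R}).$$ (These are exactly the travelling waves $r_\alpha(t)=x_{\alpha+1}-x_\alpha=R(\alpha-\sigma t)$, $v_\alpha(t)=\dot x_\alpha=V(\alpha-\sigma t)$ of the chain $\ddot x_\alpha=\Phi'(x_{\alpha+1}-x_\alpha)-\Phi'(x_\alpha-x_{\alpha-1})$, $\alpha\in\mathbb{Z}$.) For an observable $\psi(r,v)$, $[\![\psi]\!]=\psi(r_+,v_+)-\psi(r_-,v_-)$ and $\langle\psi\rangle=\tfrac12(\psi(r_+,v_+)+\psi(r_-,v_-))$. Under the hypotheses of (2) one has $[\![r]\!]\neq0$ and $[\![\Phi'(r)]\!]=\sigma^2[\![r]\!]\ne 0$, and the normalised potential is $$\widehat\Phi(w)=\frac{4}{[\![\Phi'(r)]\!]\,[\![r]\!]}\,\Phi\big(\langle r\rangle+\tfrac12[\![r]\!]w\big)-\frac{2\langle\Phi'(r)\rangle}{[\![\Phi'(r)]\!]}\,w,$$ and $g(w)=\int_{-1}^{w}\big(u-\widehat\Phi'(u)\big)\,du$. *)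

(* Defs.v *)
From Stdlib Require Import Reals.
From Coquelicot Require Import Coquelicot.
Open Scope R_scope.

Definition smooth (f : R -> R) : Prop :=
  forall (n : nat) (x : R), ex_derive (Derive_n f n) x.

Definition convex_fun (f : R -> R) : Prop :=
  forall x y t : R, 0 <= t <= 1 ->
    f (t * x + (1 - t) * y) <= t * f x + (1 - t) * f y.

Definition C1 (f : R -> R) : Prop :=
  forall x : R, ex_derive f x /\ continuous (Derive f) x.

(* bounded (for continuous functions, L^infty = bounded) *)
Definition bounded_fun (f : R -> R) : Prop :=
  exists M : R, forall x : R, Rabs (f x) <= M.

Definition monotone (f : R -> R) : Prop :=
  (forall x y, x <= y -> f x <= f y) \/ (forall x y, x <= y -> f y <= f x).

Definition front (Phi : R -> R) (sigma rm vm rp vp : R) (RR VV : R -> R) : Prop :=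
  C1 RR /\ C1 VV /\ bounded_fun RR /\ bounded_fun VV /\
  is_lim RR m_infty rm /\ is_lim RR p_infty rp /\
  is_lim VV m_infty vm /\ is_lim VV p_infty vp /\
  (forall phi : R, sigma * Derive RR phi + VV (phi + 1) - VV phi = 0) /\
  (forall phi : R, sigma * Derive VV phi + Derive Phi (RR phi) - Derive Phi (RR (phi - 1)) = 0).

Definition jump (psi : R -> R -> R) (rm vm rp vp : R) : R := psi rp vp - psi rm vm.
Definition avg (psi : R -> R -> R) (rm vm rp vp : R) : R := (psi rp vp + psi rm vm) / 2.

Definition conservative_shock (Phi : R -> R) (sigma rm vm rp vp : R) : Prop :=
  sigma * jump (fun r _ => r) rm vm rp vp + jump (fun _ v => v) rm vm rp vp = 0 /\
  sigma * jump (fun _ v => v) rm vm rp vp + jump (fun r _ => Derive Phi r) rm vm rp vp = 0 /\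
  sigma * jump (fun r v => v ^ 2 / 2 + Phi r) rm vm rp vp
    + jump (fun r v => Derive Phi r * v) rm vm rp vp = 0.

Definition Phi_hat (Phi : R -> R) (rm vm rp vp : R) (w : R) : R :=
  let jr := jump (fun r _ => r) rm vm rp vp in
  let jP := jump (fun r _ => Derive Phi r) rm vm rp vp in
  let ar := avg (fun r _ => r) rm vm rp vp in
  let aP := avg (fun r _ => Derive Phi r) rm vm rp vp in
  4 / (jP * jr) * Phi (ar + jr / 2 * w) - 2 * aP / jP * w.

Definition g_area (Phi : R -> R) (rm vm rp vp : R) (w : R) : R :=
  RInt (fun u => u - Derive (Phi_hat Phi rm vm rp vp) u) (-1) w.

(* Main.v *)
(* For part (1), each of the three conservation laws has the form [sigma f' + h (x + 1) - h x = 0];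
   then [sigma f + mean h] is constant, and comparing its limits at both infinities gives the jump condition.

   For part (2), after normalisation a front is a monotone fixed point [W], with limits -1 and 1, of
   [step F W = A* (F (A W))], where [A f x] is the integral of [f] over [x, x+1], [A*] is its adjoint and
   [F] is the derivative of the normalised potential [G]. By convexity of [G] the map [step F] preserves monotone
   profiles and lowers the energy, the integral of [(W^2 - 1) / 2 - (G (A W) - G (-1))], by at least half of the
   squared L2 norm of [step F W - W]; by Jensen the energy dominates the integral of [g (A W)], hence is
   nonnegative. Start from a ramp, so that every iterate is constant outside a bounded interval: the increments tend
   to zero, and the iterates, translated so as to vanish at 0, have a locally uniform limit point, which is a fixed
   point. Since [g > 0] between the wells, the energy bound forces its limits to be -1 and 1. *)

Require Import Defs.
From Stdlib Require Import Reals ZArith Lra Lia Cantor ClassicalEpsilon.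
From Coquelicot Require Import Coquelicot.
Open Scope R_scope.

(** * Averages over unit intervals *)

Lemma continuity_continuous (f : R -> R) (x : R) : continuity f -> continuous f x.
Proof. intros H. apply continuity_pt_filterlim, H. Qed.

Lemma continuous_continuity (f : R -> R) : (forall x, continuous f x) -> continuity f.
Proof. intros H x. apply continuity_pt_filterlim, H. Qed.

Lemma is_derive_continuity (f df : R -> R) : (forall x, is_derive f x (df x)) -> continuity f.
Proof.
intros H. apply continuous_continuity. intros x.
apply (ex_derive_continuous f). exists (df x). apply H.
Qed.

Lemma continuity_ex_RInt (f : R -> R) (a b : R) : continuity f -> ex_RInt f a b.
Proof. intros H. apply (ex_RInt_continuous (V := R_CompleteNormedModule)). intros z _. now apply continuity_continuous. Qed.

Lemma continuity_shift (f : R -> R) (s : R) : continuity f -> continuity (fun x => f (x + s)).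
Proof.
intros H. apply (continuity_comp (fun x => x + s) f); [|exact H].
apply continuous_continuity. intros x. apply (ex_derive_continuous (fun x => x + s)). auto_derive. trivial.
Qed.

Lemma is_derive_primitive (f : R -> R) (a x : R) :
  continuity f -> is_derive (fun y => RInt f a y) x (f x).
Proof.
intros H. apply (is_derive_RInt f (fun y => RInt f a y) a x).
- apply filter_forall. intros y. apply (RInt_correct (V := R_CompleteNormedModule)). now apply continuity_ex_RInt.
- now apply continuity_continuous.
Qed.

Lemma RInt_fundamental (f df : R -> R) (a b : R) :
  (forall x, is_derive f x (df x)) -> continuity df -> RInt df a b = f b - f a.
Proof.
intros H C. apply (is_RInt_unique (V := R_CompleteNormedModule)), (is_RInt_derive (V := R_CompleteNormedModule) f df).
- intros x _. apply H.
- intros x _. now apply continuity_continuous.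
Qed.

Lemma RInt_bounds (f : R -> R) (a b m M : R) :
  continuity f -> a <= b -> (forall x, a <= x <= b -> m <= f x <= M) ->
  (b - a) * m <= RInt f a b <= (b - a) * M.
Proof.
intros C ab H.
rewrite <- (RInt_const a b m : RInt (fun _ => m) a b = (b - a) * m).
rewrite <- (RInt_const a b M : RInt (fun _ => M) a b = (b - a) * M).
split; apply RInt_le; trivial; try apply ex_RInt_const; try now apply continuity_ex_RInt.
all: intros x Hx; apply H; lra.
Qed.

Lemma RInt_split (f : R -> R) (a b c : R) :
  continuity f -> RInt f a c = RInt f a b + RInt f b c.
Proof. intros C. symmetry. apply (RInt_Chasles (V := R_CompleteNormedModule) f); now apply continuity_ex_RInt. Qed.

Lemma RInt_ge_sub (f : R -> R) (a b c d : R) :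
  continuity f -> a <= b -> b <= c -> c <= d -> (forall x, a <= x <= d -> 0 <= f x) ->
  RInt f b c <= RInt f a d.
Proof.
intros C ab bc cd H.
rewrite (RInt_split f a b d C), (RInt_split f b c d C).
assert (0 <= RInt f a b).
{ apply RInt_ge_0; trivial. now apply continuity_ex_RInt. intros; apply H; lra. }
assert (0 <= RInt f c d).
{ apply RInt_ge_0; trivial. now apply continuity_ex_RInt. intros; apply H; lra. }
lra.
Qed.

Lemma RInt_zero (f : R -> R) (a b : R) :
  a <= b -> (forall x, a < x < b -> f x = 0) -> RInt f a b = 0.
Proof.
intros ab H. transitivity (RInt (fun _ => 0) a b).
- apply RInt_ext. intros x. rewrite Rmin_left, Rmax_right; auto.
- rewrite RInt_const. apply Rmult_0_r.
Qed.

Lemma RInt_shift (f : R -> R) (a b s : R) :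
  continuity f -> RInt (fun x => f (x + s)) a b = RInt f (a + s) (b + s).
Proof.
intros C. generalize (RInt_comp_lin f 1 s a b (continuity_ex_RInt _ _ _ C)).
rewrite !Rmult_1_l. intros <-. apply RInt_ext. intros x _.
unfold scal; simpl; unfold mult; simpl. now rewrite !Rmult_1_l.
Qed.

Definition mean (f : R -> R) (x : R) : R := RInt f x (x + 1).

Lemma is_derive_mean (f : R -> R) (x : R) :
  continuity f -> is_derive (mean f) x (f (x + 1) - f x).
Proof.
intros C.
assert (E : forall y : R, RInt f 0 (y + 1) - RInt f 0 y = mean f y).
{ intros y. unfold mean. rewrite (RInt_split f 0 y (y + 1) C). ring. }
apply (is_derive_ext _ _ _ _ E).
- refine (is_derive_minus _ _ _ _ _ _ (is_derive_primitive f 0 x C)).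
  rewrite <- (Rmult_1_l (f (x + 1))).
  apply (is_derive_comp (fun z => RInt f 0 z) (fun y => y + 1)).
  + now apply is_derive_primitive.
  + auto_derive; trivial.
Qed.

Lemma continuity_mean (f : R -> R) : continuity f -> continuity (mean f).
Proof. intros C. apply (is_derive_continuity _ _ (fun x => is_derive_mean f x C)). Qed.

Lemma mean_bounds (f : R -> R) (x m M : R) :
  continuity f -> (forall y, x <= y <= x + 1 -> m <= f y <= M) -> m <= mean f x <= M.
Proof.
intros C H. generalize (RInt_bounds f x (x + 1) m M C). unfold mean. intros B.
replace (x + 1 - x) with 1 in B by ring. rewrite !Rmult_1_l in B. apply B; [lra|exact H].
Qed.

Lemma mean_eq_const (f : R -> R) (x c : R) :
  continuity f -> (forall y, x <= y <= x + 1 -> f y = c) -> mean f x = c.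
Proof.
intros C H. apply Rle_antisym; apply (mean_bounds f x c c C); intros y Hy; rewrite (H y Hy); lra.
Qed.

Lemma mean_shift (f : R -> R) (s x : R) :
  continuity f -> mean (fun y => f (y + s)) x = mean f (x + s).
Proof. intros C. unfold mean. rewrite RInt_shift by exact C. now replace (x + s + 1) with (x + 1 + s) by ring. Qed.

(** Two base points are allowed, so that the case [f = g] yields monotonicity of [mean f] itself. *)
Lemma mean_le (f g : R -> R) (x y : R) :
  continuity f -> continuity g -> (forall t, 0 <= t <= 1 -> f (x + t) <= g (y + t)) ->
  mean f x <= mean g y.
Proof.
intros Cf Cg H.
replace x with (0 + x) by ring. replace y with (0 + y) by ring.
rewrite <- !mean_shift by trivial.
apply RInt_le; [lra| | |]; try (apply continuity_ex_RInt; now apply continuity_shift).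
intros t Ht. rewrite !(Rplus_comm t). apply H. lra.
Qed.

(** The boolean selects the end of the line, so one statement serves both infinities. Far out, the
    whole window [x, x+1] lies where [f] is close to [l]. *)
Lemma is_lim_mean (f : R -> R) (b : bool) (l : R) :
  continuity f -> is_lim f (if b then p_infty else m_infty) l ->
  is_lim (mean f) (if b then p_infty else m_infty) l.
Proof.
intros C H.
assert (K : forall (eps : posreal) x, (forall y, x <= y <= x + 1 -> Rabs (f y - l) < pos_div_2 eps) ->
  Rabs (mean f x - l) < eps).
{ intros eps x Hx. simpl in Hx. destruct (mean_bounds f x (l - eps / 2) (l + eps / 2) C).
  - intros y Hy. specialize (Hx y Hy). apply Rabs_def2 in Hx. lra.
  - apply Rabs_def1; generalize (cond_pos eps); lra. }
destruct b; apply is_lim_spec; apply is_lim_spec in H; intros eps;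
  destruct (H (pos_div_2 eps)) as [M HM].
- exists M. intros x Hx. apply K. intros y Hy. apply HM. lra.
(* The window reaches to x + 1, which must still lie below [M]. *)
- exists (M - 1). intros x Hx. apply K. intros y Hy. apply HM. lra.
Qed.

(* The equation says that [s * f + mean h] has zero derivative. *)
Lemma jump_of_difference_equation (f h : R -> R) (s fm fp hm hp : R) :
  (forall x, ex_derive f x) -> continuity h ->
  (forall x, s * Derive f x + (h (x + 1) - h x) = 0) ->
  is_lim f m_infty fm -> is_lim f p_infty fp ->
  is_lim h m_infty hm -> is_lim h p_infty hp ->
  s * (fp - fm) + (hp - hm) = 0.
Proof.
intros Df Ch E Lfm Lfp Lhm Lhp.
set (k := fun x => s * f x + mean h x).
assert (Dk : forall x, is_derive k x 0).
{ intros x. rewrite <- (E x). apply (is_derive_plus (fun x => s * f x) (mean h)).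
  - refine (is_derive_scal _ _ _ _ _). apply Derive_correct, Df.
  - now apply is_derive_mean. }
assert (Kc : forall x, k x = k 0).
{ intros x. destruct (Rtotal_order x 0) as [L|[->|L]]; trivial.
  - apply (eq_is_derive k x 0); trivial.
  - symmetry. apply (eq_is_derive k 0 x); trivial. }
assert (Lk : forall (b : bool) fl hl, is_lim f (if b then p_infty else m_infty) (Finite fl) ->
   is_lim h (if b then p_infty else m_infty) (Finite hl) -> s * fl + hl = k 0).
{ intros b fl hl H1 H2.
  assert (L1 : is_lim k (if b then p_infty else m_infty) (Finite (s * fl + hl))).
  { apply (is_lim_plus' (fun x => s * f x) (mean h)).
    - apply (is_lim_scal_l f s _ (Finite fl) H1).
    - now apply is_lim_mean. }
  apply is_lim_unique in L1.
  rewrite (Lim_ext (fun _ => k 0) k), Lim_const in L1 by (intros; symmetry; trivial).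
  now injection L1. }
generalize (Lk true _ _ Lfp Lhp) (Lk false _ _ Lfm Lhm). lra.
Qed.

(** * Jump conditions of a front *)

Lemma is_lim_continuity_comp (f g : R -> R) (x : Rbar) (l : R) :
  continuity f -> is_lim g x l -> is_lim (fun y => f (g y)) x (f l).
Proof.
intros C H. unfold is_lim. apply (filterlim_comp _ _ _ g f _ (Rbar_locally l)); [exact H|].
apply (continuity_continuous f l C).
Qed.

(** In the second and third laws the flux contains Phi'(R) at the delayed argument x - 1, which
    turns the backward difference of the second equation into a forward one. *)
Lemma front_jump_conditions (Phi : R -> R) (sigma rm vm rp vp : R) (RR VV : R -> R) :
  smooth Phi -> front Phi sigma rm vm rp vp RR VV -> conservative_shock Phi sigma rm vm rp vp.
Proof.
intros S (CR & CV & _ & _ & Rm & Rp & Vm & Vp & E1 & E2).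
assert (cR : continuity RR).
{ apply (is_derive_continuity _ (Derive RR)). intros x. apply Derive_correct, CR. }
assert (cV : continuity VV).
{ apply (is_derive_continuity _ (Derive VV)). intros x. apply Derive_correct, CV. }
assert (cPhi : continuity Phi).
{ apply (is_derive_continuity _ (Derive Phi)). intros x. apply Derive_correct, (S 0%nat). }
assert (cP : continuity (Derive Phi)).
{ apply (is_derive_continuity _ (Derive (Derive Phi))). intros x. apply Derive_correct, (S 1%nat). }
assert (cPR : continuity (fun x => Derive Phi (RR (x - 1)))).
{ apply (continuity_shift (fun x => Derive Phi (RR x))). now apply (continuity_comp RR (Derive Phi)). }
assert (Lshift : forall (b : bool) l, is_lim RR (if b then p_infty else m_infty) (Finite l) ->
   is_lim (fun x => RR (x - 1)) (if b then p_infty else m_infty) (Finite l)).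
{ intros b l H. destruct b; apply is_lim_spec; apply is_lim_spec in H; intros eps;
    destruct (H eps) as [M HM]; [exists (M + 1)|exists M]; intros x Hx; apply HM; lra. }
assert (LP := fun b l H => is_lim_continuity_comp (Derive Phi) (fun x => RR (x - 1)) _ l cP (Lshift b l H)).
unfold conservative_shock, jump.
repeat split.
- apply (jump_of_difference_equation RR VV); trivial.
  + intros x; apply CR.
  + intros x. rewrite <- (E1 x). ring.
- apply (jump_of_difference_equation VV (fun x => Derive Phi (RR (x - 1)))); trivial.
  + intros x; apply CV.
  + intros x. rewrite <- (E2 x). replace (x + 1 - 1) with x by ring. ring.
  + apply (LP false _ Rm).
  + apply (LP true _ Rp).
- apply (jump_of_difference_equation (fun x => VV x ^ 2 / 2 + Phi (RR x))
    (fun x => Derive Phi (RR (x - 1)) * VV x)).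
  + intros x. auto_derive. repeat split; try apply CV; try apply CR. apply (S 0%nat).
  + now apply (continuity_mult (fun x => Derive Phi (RR (x - 1))) VV).
  + intros x.
    (* Local energy balance: V times the second equation plus Phi'(R) times the first; the terms
       Phi'(R(x)) V(x) cancel. *)
    replace (Derive (fun x => VV x ^ 2 / 2 + Phi (RR x)) x)
      with (VV x * Derive VV x + Derive Phi (RR x) * Derive RR x).
    * replace (x + 1 - 1) with x by ring.
      replace (sigma * _) with (VV x * (sigma * Derive VV x) + Derive Phi (RR x) * (sigma * Derive RR x)) by ring.
      replace (sigma * Derive VV x) with (Derive Phi (RR (x - 1)) - Derive Phi (RR x))
        by (generalize (E2 x); lra).
      replace (sigma * Derive RR x) with (VV x - VV (x + 1)) by (generalize (E1 x); lra).
      ring.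
    * symmetry. apply is_derive_unique. auto_derive.
      -- repeat split; try apply CV; try apply CR. apply (S 0%nat).
      -- change (Derive (fun z => RR z)) with (Derive RR). change (Derive (fun z => VV z)) with (Derive VV).
         change (Derive (fun z => Phi z)) with (Derive Phi). field.
  + apply (is_lim_plus' (fun x => VV x ^ 2 / 2) (fun x => Phi (RR x))).
    * apply (is_lim_continuity_comp (fun v => v ^ 2 / 2)); trivial. intros x; reg.
    * now apply is_lim_continuity_comp.
  + apply (is_lim_plus' (fun x => VV x ^ 2 / 2) (fun x => Phi (RR x))).
    * apply (is_lim_continuity_comp (fun v => v ^ 2 / 2)); trivial. intros x; reg.
    * now apply is_lim_continuity_comp.
  + apply (is_lim_mult (fun x => Derive Phi (RR (x - 1))) VV _ (Derive Phi rm) vm);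
      [apply (LP false _ Rm)|trivial|exact I].
  + apply (is_lim_mult (fun x => Derive Phi (RR (x - 1))) VV _ (Derive Phi rp) vp);
      [apply (LP true _ Rp)|trivial|exact I].
Qed.

(** * Energy *)

Definition nondecreasing (f : R -> R) : Prop := forall x y, x <= y -> f x <= f y.

(** The area function g of the theorem in integrated form, with [G] as the normalised potential. *)
Definition well (G : R -> R) (w : R) : R := (w ^ 2 - 1) / 2 - (G w - G (-1)).

(** What the iteration uses of the normalised potential: [bw_tangent] is convexity, [bw_balance]
    comes from the energy jump condition, and [bw_well] is the area condition. *)
Record balanced_wells (G F : R -> R) : Prop := {
  bw_derive : forall x, is_derive G x (F x);
  bw_continuity : continuity F;
  bw_tangent : forall a b, G a + F a * (b - a) <= G b;
  bw_left : F (-1) = -1;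
  bw_right : F 1 = 1;
  bw_balance : G 1 = G (-1);
  bw_well : forall w, -1 < w < 1 -> 0 < well G w }.

(** A class invariant under [step], translations and pointwise limits. The slope bound 2 is the
    length of [-1, 1], since [mean f] has derivative f(x+1) - f(x). *)
Record tame (W : R -> R) : Prop := {
  tame_incr : nondecreasing W;
  tame_lip : forall x y, x <= y -> W y - W x <= 2 * (y - x);
  tame_bounds : forall x, -1 <= W x <= 1 }.

Definition saturated (N : R) (W : R -> R) : Prop :=
  (forall x, x <= - N -> W x = -1) /\ (forall x, N <= x -> W x = 1).

(** The outer average runs over [x-1, x]: it is the adjoint of [mean]. *)
Definition step (F W : R -> R) (x : R) : R := mean (fun y => F (mean W y)) (x - 1).

Definition density (G W : R -> R) (x : R) : R := (W x ^ 2 - 1) / 2 - (G (mean W x) - G (-1)).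

(** For saturated profiles the density has compact support, so a large window [M] replaces the
    integral over the line. *)
Definition energy (G : R -> R) (M : R) (W : R -> R) : R := RInt (density G W) (- M) M.

Lemma tame_continuity (W : R -> R) : tame W -> continuity W.
Proof.
intros [I L _] x eps He. exists (eps / 2). split; [lra|].
intros y [_ D]. simpl in *. unfold Rdist in *. apply Rabs_def2 in D.
destruct (Rle_dec x y) as [xy|xy].
- generalize (I x y xy) (L x y xy). intros. apply Rabs_def1; lra.
- assert (yx : y <= x) by lra. generalize (I y x yx) (L y x yx). intros. apply Rabs_def1; lra.
Qed.

Lemma bw_nondecreasing (G F : R -> R) : balanced_wells G F -> nondecreasing F.
Proof.
intros B x y [xy| ->]; [|lra].
generalize (bw_tangent _ _ B x y) (bw_tangent _ _ B y x). intros.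
(* Sum of the tangent inequalities at [x] and at [y]. *)
assert (0 <= (F y - F x) * (y - x)) by lra.
destruct (Rle_dec (F x) (F y)); trivial. exfalso.
assert (0 < (F x - F y) * (y - x)) by (apply Rmult_lt_0_compat; lra). lra.
Qed.

Lemma bw_range (G F : R -> R) (w : R) : balanced_wells G F -> -1 <= w <= 1 -> -1 <= F w <= 1.
Proof.
intros B [H1 H2]. generalize (bw_nondecreasing G F B _ _ H1) (bw_nondecreasing G F B _ _ H2).
rewrite (bw_left _ _ B), (bw_right _ _ B). lra.
Qed.

Lemma bw_continuity_potential (G F : R -> R) : balanced_wells G F -> continuity G.
Proof. intros B. apply (is_derive_continuity _ _ (bw_derive _ _ B)). Qed.

Lemma continuity_well (G F : R -> R) : balanced_wells G F -> continuity (well G).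
Proof.
intros B. unfold well. apply (continuity_minus (fun w => (w ^ 2 - 1) / 2)).
- intros x; reg.
- apply (continuity_minus G (fun _ => G (-1))).
  + now apply (bw_continuity_potential _ F).
  + apply continuity_const. now intros x y.
Qed.

Lemma well_nonneg (G F : R -> R) (w : R) : balanced_wells G F -> -1 <= w <= 1 -> 0 <= well G w.
Proof.
intros B [[H1|H1] [H2|H2]].
- left. now apply (bw_well _ _ B).
- subst w. unfold well. rewrite (bw_balance _ _ B). lra.
- subst w. unfold well. lra.
- lra.
Qed.

Lemma mean_nondecreasing (f : R -> R) : continuity f -> nondecreasing f -> nondecreasing (mean f).
Proof. intros C I x y xy. apply mean_le; trivial. intros t Ht. apply I. lra. Qed.

(** Moving the window from [x] to [y] gains the integral over [x+1, y+1] and loses the one over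
    [x, y], each at most y - x in absolute value. *)
Lemma mean_lipschitz (f : R -> R) (x y : R) :
  continuity f -> (forall x, -1 <= f x <= 1) -> x <= y -> mean f y - mean f x <= 2 * (y - x).
Proof.
intros C H xy. unfold mean.
replace (RInt f y (y + 1) - RInt f x (x + 1)) with (RInt f (x + 1) (y + 1) - RInt f x y).
- generalize (RInt_bounds f x y (-1) 1 C xy (fun z _ => H z)).
  generalize (RInt_bounds f (x + 1) (y + 1) (-1) 1 C ltac:(lra) (fun z _ => H z)). lra.
- generalize (RInt_split f x (x + 1) (y + 1) C) (RInt_split f x y (y + 1) C). lra.
Qed.

Lemma continuity_response (G F W : R -> R) :
  balanced_wells G F -> continuity W -> continuity (fun y => F (mean W y)).
Proof.
intros B C. apply (continuity_comp (mean W) F); [now apply continuity_mean|apply (bw_continuity _ _ B)].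
Qed.

Lemma mean_tame_bounds (W : R -> R) (x : R) : tame W -> -1 <= mean W x <= 1.
Proof. intros T. apply mean_bounds. now apply tame_continuity. intros y _. apply (tame_bounds _ T). Qed.

Lemma response_nondecreasing (G F W : R -> R) :
  balanced_wells G F -> tame W -> nondecreasing (fun y => F (mean W y)).
Proof.
intros B T x y xy. apply (bw_nondecreasing G F B). apply mean_nondecreasing; trivial.
now apply tame_continuity. apply (tame_incr _ T).
Qed.

(** The Lipschitz bound comes from the outer average: it suffices that [F] maps [-1, 1] into
    itself. *)
Lemma step_tame (G F W : R -> R) : balanced_wells G F -> tame W -> tame (step F W).
Proof.
intros B T. assert (C := continuity_response G F W B (tame_continuity W T)).
assert (Bd : forall y, -1 <= F (mean W y) <= 1).
{ intros y. apply (bw_range G F _ B), mean_tame_bounds, T. }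
split.
- intros x y xy. apply (mean_nondecreasing _ C); [|lra]. now apply (response_nondecreasing G).
- intros x y xy. unfold step. replace (y - x) with (y - 1 - (x - 1)) by ring.
  apply mean_lipschitz; trivial. lra.
- intros x. apply mean_bounds; trivial.
Qed.

Lemma mean_saturated (N : R) (W : R -> R) :
  continuity W -> saturated N W ->
  (forall x, x <= - N - 1 -> mean W x = -1) /\ (forall x, N <= x -> mean W x = 1).
Proof.
intros C [L R]. split; intros x Hx; apply mean_eq_const; trivial; intros y Hy; [apply L|apply R]; lra.
Qed.

(** The inner average looks ahead and widens the transition zone by 1 on the left; the outer one
    looks back and widens it by 1 on the right. *)
Lemma step_saturated (G F W : R -> R) (N : R) :
  balanced_wells G F -> continuity W -> saturated N W -> saturated (N + 1) (step F W).
Proof.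
intros B C S. assert (CF := continuity_response G F W B C).
destruct (mean_saturated N W C S) as [L R].
split; intros x Hx; apply mean_eq_const; trivial; intros y Hy.
- rewrite L by lra. apply (bw_left _ _ B).
- rewrite R by lra. apply (bw_right _ _ B).
Qed.

Lemma continuity_density (G F W : R -> R) :
  balanced_wells G F -> continuity W -> continuity (density G W).
Proof.
intros B C. unfold density.
apply (continuity_minus (fun x => (W x ^ 2 - 1) / 2) (fun x => G (mean W x) - G (-1))).
- apply (continuity_comp W (fun w => (w ^ 2 - 1) / 2)); trivial. intros x; reg.
- apply (continuity_minus (fun x => G (mean W x)) (fun _ => G (-1))).
  + apply (continuity_comp (mean W) G). now apply continuity_mean. now apply (bw_continuity_potential _ F).
  + apply continuity_const. now intros x y.
Qed.

(** The density vanishes outside [-N-1, N]; to the right of it because both wells have the same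
    depth. *)
Lemma energy_window (G F W : R -> R) (N M M' : R) :
  balanced_wells G F -> continuity W -> saturated N W -> 0 <= N -> N + 1 <= M -> M <= M' ->
  energy G M' W = energy G M W.
Proof.
intros B C S N0 NM MM. assert (CD := continuity_density G F W B C).
destruct (mean_saturated N W C S) as [L R]. destruct S as [SL SR].
unfold energy. rewrite (RInt_split _ (- M') (- M) M' CD), (RInt_split _ (- M) M M' CD).
rewrite (RInt_zero _ (- M') (- M)), (RInt_zero _ M M'); try lra.
- intros x Hx. unfold density. rewrite SR, R by lra. rewrite (bw_balance _ _ B). lra.
- intros x Hx. unfold density. rewrite SL, L by lra. lra.
Qed.

(** Integration by parts takes the place of Fubini. The margin of 1 on the left makes [mean z]
    vanish at [- M] too, since its window looks to the right. *)
Lemma mean_adjoint (h z : R -> R) (M : R) :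
  continuity h -> continuity z ->
  (forall x, x <= - M + 1 -> z x = 0) -> (forall x, M <= x -> z x = 0) ->
  RInt (fun x => h x * mean z x) (- M) M = RInt (fun x => mean h (x - 1) * z x) (- M) M.
Proof.
intros Ch Cz ZL ZR.
set (H := (fun x => RInt h 0 x) : R -> R).
assert (DH : forall x, is_derive H x (h x)) by (intros x; now apply is_derive_primitive).
assert (CH : continuity H) by apply (is_derive_continuity _ _ DH).
set (k := fun y => H (y - 1) * z y).
assert (Ck : continuity k).
{ apply (continuity_mult (fun y => H (y - 1)) z); trivial. now apply (continuity_shift H). }
assert (Ca : continuity (fun x => h x * mean z x)).
{ apply (continuity_mult h (mean z)); trivial. now apply continuity_mean. }
assert (Cb : continuity (fun x => mean h (x - 1) * z x)).
{ apply (continuity_mult (fun x => mean h (x - 1)) z); trivial.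
  apply (continuity_shift (mean h)). now apply continuity_mean. }
(* A primitive of the difference of the two integrands which vanishes at both ends. *)
assert (D : forall x : R, is_derive (fun x => H x * mean z x - mean k x) x
  (h x * mean z x - mean h (x - 1) * z x)).
{ intros x.
  replace (h x * mean z x - mean h (x - 1) * z x)
    with ((h x * mean z x + H x * (z (x + 1) - z x)) - (k (x + 1) - k x)).
  - apply (is_derive_minus (fun x => H x * mean z x) (mean k)); [|now apply is_derive_mean].
    apply (is_derive_mult H (mean z)); trivial. now apply is_derive_mean. intros; apply Rmult_comm.
  - assert (E1 : mean h (x - 1) = H x - H (x - 1)).
    { unfold mean, H. rewrite (RInt_split h 0 (x - 1) x Ch). replace (x - 1 + 1) with x by ring. lra. }
    rewrite E1. unfold k. replace (x + 1 - 1) with x by ring. ring. }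
assert (E := RInt_fundamental _ _ (- M) M D
  (continuity_minus _ _ Ca Cb)).
rewrite (RInt_minus (V := R_CompleteNormedModule) (fun x => h x * mean z x) (fun x => mean h (x - 1) * z x)) in E
  by now apply continuity_ex_RInt.
rewrite (mean_eq_const z M 0), (mean_eq_const z (- M) 0), (mean_eq_const k M 0), (mean_eq_const k (- M) 0) in E; trivial.
- unfold minus, plus, opp in E; simpl in E. lra.
- intros y Hy. unfold k. rewrite ZL by lra. ring.
- intros y Hy. unfold k. rewrite ZR by lra. ring.
- intros y Hy. apply ZL; lra.
- intros y Hy. apply ZR; lra.
Qed.

(** * Decrease of the energy and its lower bound *)

Lemma RInt_plus_R (f g : R -> R) (a b : R) :
  continuity f -> continuity g -> RInt (fun x => f x + g x) a b = RInt f a b + RInt g a b.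
Proof. intros Cf Cg. apply (RInt_plus (V := R_CompleteNormedModule) f g); now apply continuity_ex_RInt. Qed.

Lemma RInt_minus_R (f g : R -> R) (a b : R) :
  continuity f -> continuity g -> RInt (fun x => f x - g x) a b = RInt f a b - RInt g a b.
Proof. intros Cf Cg. apply (RInt_minus (V := R_CompleteNormedModule) f g); now apply continuity_ex_RInt. Qed.

Lemma RInt_scal_R (f : R -> R) (c a b : R) :
  continuity f -> RInt (fun x => c * f x) a b = c * RInt f a b.
Proof. intros Cf. apply (RInt_scal (V := R_CompleteNormedModule) f); now apply continuity_ex_RInt. Qed.

Lemma mean_minus (f g : R -> R) (x : R) :
  continuity f -> continuity g -> mean (fun y => f y - g y) x = mean f x - mean g x.
Proof. apply RInt_minus_R. Qed.

Lemma continuity_square (f : R -> R) : continuity f -> continuity (fun x => f x ^ 2).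
Proof. intros C. apply (continuity_comp f (fun w => w ^ 2)); trivial. intros x; reg. Qed.

(** Jensen for the square: the variance, the average of (f - c)^2 with c the mean, is
    nonnegative. *)
Lemma mean_square_le (f : R -> R) (x : R) :
  continuity f -> mean f x ^ 2 <= mean (fun y => f y ^ 2) x.
Proof.
intros C. set (c := mean f x).
assert (P : 0 <= mean (fun y => (f y ^ 2 - 2 * c * f y) + c ^ 2) x).
{ apply RInt_ge_0; [lra| |].
  - apply continuity_ex_RInt. intros y. assert (Cy := C y). reg.
  - intros y _. replace (f y ^ 2 - 2 * c * f y + c ^ 2) with ((f y - c) ^ 2) by ring. apply pow2_ge_0. }
assert (C2 := continuity_square f C).
assert (C1' : continuity (fun y => 2 * c * f y)) by now apply (continuity_scal f).
assert (C0 : continuity (fun _ => c ^ 2)) by (apply continuity_const; now intros ? ?).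
unfold mean in P.
rewrite (RInt_plus_R (fun y => f y ^ 2 - 2 * c * f y) (fun _ => c ^ 2)) in P
  by (trivial; now apply (continuity_minus (fun y => f y ^ 2))).
rewrite (RInt_minus_R (fun y => f y ^ 2)), RInt_scal_R in P by trivial.
fold (mean f x) in P. fold c in P. fold (mean (fun y => f y ^ 2) x) in P.
fold (mean (fun _ => c ^ 2) x) in P. rewrite (mean_eq_const (fun _ => c ^ 2) x (c ^ 2)) in P by trivial.
lra.
Qed.

(* Convexity of [G] bounds [G (mean (step F W))] from below by its tangent at [mean W];
   the linear term is then moved through [mean_adjoint], whose dual average of [F (mean W)] is [step F W]. *)
Lemma energy_step (G F W : R -> R) (N M : R) :
  balanced_wells G F -> tame W -> saturated N W -> 0 <= N -> N + 2 <= M ->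
  energy G M (step F W) + RInt (fun x => (step F W x - W x) ^ 2) (- M) M / 2 <= energy G M W.
Proof.
intros B T S N0 NM.
assert (CW := tame_continuity _ T). assert (TS := step_tame G F W B T).
assert (CS := tame_continuity _ TS). assert (SS := step_saturated G F W N B CW S).
set (z := fun x => step F W x - W x). set (h := fun x => F (mean W x)).
assert (Ch : continuity h) by now apply (continuity_response G).
assert (Cz : continuity z) by now apply continuity_minus.
assert (Cz2 := continuity_square z Cz).
assert (C1' : continuity (fun x => h x * mean z x)).
{ apply (continuity_mult h (mean z)); trivial. now apply continuity_mean. }
assert (C2' : continuity (fun x => mean h (x - 1) * z x)) by now apply (continuity_mult (step F W)).
assert (D1 := continuity_density G F W B CW). assert (D2 := continuity_density G F _ B CS).
(* [z] vanishes outside [-N-1, N+1]; the margin asked for by [mean_adjoint] explains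
   [N + 2 <= M]. *)
assert (Adj : RInt (fun x => h x * mean z x) (- M) M = RInt (fun x => mean h (x - 1) * z x) (- M) M).
{ apply mean_adjoint; trivial; intros x Hx; unfold z.
  - rewrite (proj1 S), (proj1 SS) by lra. ring.
  - rewrite (proj2 S), (proj2 SS) by lra. ring. }
(* With S = [step F W] and z = S - W one has (S^2 - W^2) / 2 + z^2 / 2 = S z, and S(x) is
   [mean h (x - 1)]. The two products on the right cancel after integration. *)
assert (I : RInt (fun x => density G (step F W) x + 1 / 2 * z x ^ 2) (- M) M <=
  RInt (fun x => density G W x + (mean h (x - 1) * z x - h x * mean z x)) (- M) M).
{ apply RInt_le; [lra| | |].
  - apply continuity_ex_RInt. apply (continuity_plus (density G (step F W))); trivial.
    now apply (continuity_scal (fun x => z x ^ 2)).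
  - apply continuity_ex_RInt. apply (continuity_plus (density G W)); trivial.
    now apply (continuity_minus (fun x => mean h (x - 1) * z x)).
  - intros x _. fold (step F W x). unfold density, z, h.
    change (mean (fun y => F (mean W y)) (x - 1)) with (step F W x).
    rewrite (mean_minus (step F W) W x) by trivial.
    generalize (bw_tangent _ _ B (mean W x) (mean (step F W) x)). lra. }
rewrite (RInt_plus_R (density G (step F W)) (fun x => 1 / 2 * z x ^ 2)), RInt_scal_R,
  (RInt_plus_R (density G W)), (RInt_minus_R (fun x => mean h (x - 1) * z x)), <- Adj in I; trivial.
- unfold energy. fold z. unfold z in *. lra.
- now apply (continuity_minus (fun x => mean h (x - 1) * z x)).
- now apply (continuity_scal (fun x => z x ^ 2)).
Qed.

(** The density exceeds [well G (mean W x)] by half of W^2 - (mean W)^2, which by Jensen is at least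
    W^2 - mean (W^2). The latter integrates to zero, by adjointness against the constant 1;
    subtracting 1 from W^2 gives the compact support needed. *)
Lemma energy_ge_well (G F W : R -> R) (N M : R) :
  balanced_wells G F -> tame W -> saturated N W -> 0 <= N -> N + 1 <= M ->
  RInt (fun x => well G (mean W x)) (- M) M <= energy G M W.
Proof.
intros B T S N0 NM.
assert (CW := tame_continuity _ T). assert (CA := continuity_mean W CW).
set (z := fun x => W x ^ 2 - 1).
assert (C1' : continuity (fun _ : R => 1)) by (apply continuity_const; now intros ? ?).
assert (Cz : continuity z) by (apply (continuity_minus (fun x => W x ^ 2)); trivial; now apply continuity_square).
assert (Cm := continuity_mean z Cz).
assert (Cw : continuity (fun x => well G (mean W x))).
{ apply (continuity_comp (mean W) (well G)); trivial. now apply (continuity_well G F). }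
assert (Adj : RInt (mean z) (- M) M = RInt z (- M) M).
{ transitivity (RInt (fun x => 1 * mean z x) (- M) M); [apply RInt_ext; intros; symmetry; apply Rmult_1_l|].
  rewrite (mean_adjoint (fun _ => 1)); trivial.
  - apply RInt_ext; intros x _. rewrite (mean_eq_const (fun _ => 1) _ 1) by trivial. apply Rmult_1_l.
  - intros x Hx. unfold z. rewrite (proj1 S) by lra. ring.
  - intros x Hx. unfold z. rewrite (proj2 S) by lra. ring. }
assert (I : RInt (fun x => well G (mean W x) + 1 / 2 * (z x - mean z x)) (- M) M <= energy G M W).
{ assert (Czm : continuity (fun x => z x - mean z x)) by now apply (continuity_minus z).
  apply RInt_le; [lra| | |].
  - apply continuity_ex_RInt. apply (continuity_plus (fun x => well G (mean W x))); trivial.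
    now apply (continuity_scal (fun x => z x - mean z x)).
  - apply continuity_ex_RInt. now apply (continuity_density G F).
  - intros x _. unfold density, well, z.
    rewrite (mean_minus (fun y => W y ^ 2) (fun _ => 1)) by (trivial; now apply continuity_square).
    rewrite (mean_eq_const (fun _ => 1) _ 1) by trivial. generalize (mean_square_le W x CW). lra. }
rewrite (RInt_plus_R (fun x => well G (mean W x))), RInt_scal_R, (RInt_minus_R z), Adj in I; trivial.
- lra.
- now apply (continuity_minus z).
- apply (continuity_scal (fun x => z x - mean z x)). now apply (continuity_minus z).
Qed.

(* The integrand stays above [(z x / 2) ^ 2] on an interval of length [|z x| / 8] to the right of [x]. *)
Lemma pointwise_le_square_integral (z : R -> R) (a b x : R) :
  continuity z -> (forall x y, x <= y -> Rabs (z y - z x) <= 4 * (y - x)) -> Rabs (z x) <= 8 ->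
  a <= x -> x + 1 <= b -> Rabs (z x) ^ 3 / 32 <= RInt (fun x => z x ^ 2) a b.
Proof.
intros C L B ax xb. set (d := Rabs (z x)) in *.
assert (d0 : 0 <= d) by apply Rabs_pos.
assert (C2 := continuity_square z C).
apply Rle_trans with (RInt (fun x => z x ^ 2) x (x + d / 8)).
- replace (d ^ 3 / 32) with ((x + d / 8 - x) * ((d / 2) ^ 2)) by field.
  apply Rle_trans with (RInt (fun _ : R => (d / 2) ^ 2) x (x + d / 8)); [right; symmetry; apply (RInt_const x (x + d / 8) ((d/2)^2))|].
  apply RInt_le; [lra|apply ex_RInt_const|now apply continuity_ex_RInt|].
  intros y Hy. rewrite <- (pow2_abs (z y)). apply pow_incr. split; [lra|].
  generalize (L x y ltac:(lra)) (Rabs_triang_inv (z x) (z x - z y)).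
  replace (z x - (z x - z y)) with (z y) by ring. rewrite (Rabs_minus_sym (z x)). fold d. lra.
- apply RInt_ge_sub; trivial; try lra. intros y _. apply pow2_ge_0.
Qed.

(** * The iteration *)

Definition ramp (x : R) : R := Rmax (-1) (Rmin 1 x).

Lemma ramp_tame : tame ramp.
Proof.
split; unfold ramp, Rmax, Rmin.
- intros x y xy. repeat destruct Rle_dec; lra.
- intros x y xy. repeat destruct Rle_dec; lra.
- intros x. repeat destruct Rle_dec; lra.
Qed.

Lemma ramp_saturated : saturated 1 ramp.
Proof. split; intros x Hx; unfold ramp, Rmax, Rmin; repeat destruct Rle_dec; lra. Qed.

Definition iterate (F : R -> R) (n : nat) : R -> R := Nat.iter n (step F) ramp.

Lemma iterate_tame (G F : R -> R) (n : nat) : balanced_wells G F -> tame (iterate F n).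
Proof. intros B. induction n; [apply ramp_tame|now apply (step_tame G)]. Qed.

Lemma iterate_saturated (G F : R -> R) (n : nat) :
  balanced_wells G F -> saturated (INR n + 1) (iterate F n).
Proof.
intros B. induction n as [|n IH].
- simpl. rewrite Rplus_0_l. apply ramp_saturated.
- rewrite S_INR. exact (step_saturated G F _ _ B (tame_continuity _ (iterate_tame G F n B)) IH).
Qed.

(** The transition zone of the n-th iterate has radius at most n + 1, so this window captures its
    whole energy. *)
Definition level (G F : R -> R) (n : nat) : R := energy G (INR n + 3) (iterate F n).

Lemma energy_iterate (G F : R -> R) (n : nat) (M : R) :
  balanced_wells G F -> INR n + 3 <= M -> energy G M (iterate F n) = level G F n.
Proof.
intros B HM. assert (Hn := pos_INR n). apply (energy_window G F _ (INR n + 1)); trivial; try lra.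
- apply tame_continuity. exact (iterate_tame G F n B).
- exact (iterate_saturated G F n B).
Qed.

(** The energy drop controls the increment in L2, and the Lipschitz bound turns this into pointwise
    control; 64 is 32 from [pointwise_le_square_integral] times 2 from [energy_step]. *)
Lemma level_step (G F : R -> R) (n : nat) (x : R) :
  balanced_wells G F ->
  Rabs (iterate F (S n) x - iterate F n x) ^ 3 / 64 <= level G F n - level G F (S n).
Proof.
intros B. assert (Hn := pos_INR n).
assert (T1 := iterate_tame G F n B). assert (T2 := iterate_tame G F (S n) B).
assert (S1 := iterate_saturated G F n B). assert (S2 := iterate_saturated G F (S n) B).
assert (Cz : continuity (fun x => iterate F (S n) x - iterate F n x)).
{ apply (continuity_minus (iterate F (S n)) (iterate F n)); now apply tame_continuity. }
assert (Q : RInt (fun x => (iterate F (S n) x - iterate F n x) ^ 2) (- (INR n + 4)) (INR n + 4) / 2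
  <= level G F n - level G F (S n)).
{ rewrite <- (energy_iterate G F n (INR n + 4)), <- (energy_iterate G F (S n) (INR n + 4))
    by (trivial; rewrite ?S_INR; lra).
  generalize (energy_step G F (iterate F n) (INR n + 1) (INR n + 4) B T1 S1 ltac:(lra) ltac:(lra)).
  change (step F (iterate F n)) with (iterate F (S n)). lra. }
apply Rle_trans with (2 := Q).
(* If [x, x+1] fits into the window the pointwise estimate applies; otherwise both iterates are
   saturated at [x] and agree. *)
destruct (Rle_dec (- (INR n + 4)) x) as [xl|xl]; [destruct (Rle_dec (x + 1) (INR n + 4)) as [xr|xr]|].
- generalize (pointwise_le_square_integral (fun x => iterate F (S n) x - iterate F n x)
    (- (INR n + 4)) (INR n + 4) x Cz).
  intros H. cut (Rabs (iterate F (S n) x - iterate F n x) ^ 3 / 32 <=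
    RInt (fun x => (iterate F (S n) x - iterate F n x) ^ 2) (- (INR n + 4)) (INR n + 4)); [lra|].
  apply H; trivial.
  + intros y t yt. generalize (tame_incr _ T1 y t yt) (tame_incr _ T2 y t yt)
      (tame_lip _ T1 y t yt) (tame_lip _ T2 y t yt). intros. apply Rabs_le. lra.
  + generalize (tame_bounds _ T1 x) (tame_bounds _ T2 x). intros. apply Rabs_le. lra.
- rewrite (proj2 S1), (proj2 S2) by (rewrite ?S_INR; lra).
  rewrite Rminus_diag, Rabs_R0. replace (0 ^ 3 / 64) with 0 by field.
  apply Rdiv_le_0_compat; [|lra]. apply RInt_ge_0; [lra| |intros; apply pow2_ge_0].
  apply continuity_ex_RInt. now apply continuity_square.
- rewrite (proj1 S1), (proj1 S2) by (rewrite ?S_INR; lra).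
  rewrite Rminus_diag, Rabs_R0. replace (0 ^ 3 / 64) with 0 by field.
  apply Rdiv_le_0_compat; [|lra]. apply RInt_ge_0; [lra| |intros; apply pow2_ge_0].
  apply continuity_ex_RInt. now apply continuity_square.
Qed.

Lemma level_decr (G F : R -> R) (n : nat) : balanced_wells G F -> level G F (S n) <= level G F n.
Proof.
intros B. generalize (level_step G F n 0 B) (pow_le _ 3 (Rabs_pos (iterate F (S n) 0 - iterate F n 0))). lra.
Qed.

(** The integrand is nonnegative, so any interval may be enlarged to a full window. A bound on all
    intervals survives translation of the iterates. *)
Lemma well_integral_le (G F : R -> R) (n : nat) (a b : R) :
  balanced_wells G F -> a <= b ->
  RInt (fun x => well G (mean (iterate F n) x)) a b <= level G F n.
Proof.
intros B ab. assert (Hn := pos_INR n). assert (T := iterate_tame G F n B).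
set (M := INR n + 3 + Rabs a + Rabs b).
assert (Ha := Rabs_pos a). assert (Hb := Rabs_pos b).
rewrite <- (energy_iterate G F n M) by (trivial; unfold M; lra).
apply Rle_trans with (RInt (fun x => well G (mean (iterate F n) x)) (- M) M).
- apply RInt_ge_sub; trivial.
  + apply (continuity_comp (mean (iterate F n)) (well G)); [|now apply (continuity_well G F)].
    now apply continuity_mean, tame_continuity.
  + unfold M. generalize (Rle_abs (- a)). rewrite Rabs_Ropp. lra.
  + unfold M. generalize (Rle_abs b). lra.
  + intros x _. now apply (well_nonneg G F), mean_tame_bounds.
- apply (energy_ge_well G F _ (INR n + 1)); trivial; unfold M; try lra. exact (iterate_saturated G F n B).
Qed.

Lemma level_nonneg (G F : R -> R) (n : nat) : balanced_wells G F -> 0 <= level G F n.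
Proof.
intros B. apply Rle_trans with (2 := well_integral_le G F n 0 0 B (Rle_refl 0)).
right. symmetry. apply (RInt_point (V := R_CompleteNormedModule) 0).
Qed.

Lemma level_le_0 (G F : R -> R) (n : nat) : balanced_wells G F -> level G F n <= level G F 0.
Proof. intros B. induction n; [lra|]. generalize (level_decr G F n B). lra. Qed.

(** The levels decrease and are nonnegative, so their drops tend to zero. The point may move with
    [n], as the later translations require. *)
Lemma iterate_increment_lim (G F : R -> R) (y : nat -> R) :
  balanced_wells G F ->
  is_lim_seq (fun n => iterate F (S n) (y n) - iterate F n (y n)) 0.
Proof.
intros B.
destruct (ex_finite_lim_seq_decr (level G F) 0) as [l Hl].
{ intros n. now apply level_decr. }
{ intros n. now apply level_nonneg. }
assert (D : is_lim_seq (fun n => level G F n - level G F (S n)) (l - l)).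
{ apply is_lim_seq_minus'; trivial. now apply -> is_lim_seq_incr_1. }
rewrite Rminus_diag in D. apply is_lim_seq_spec. apply is_lim_seq_spec in D. intros eps.
assert (E3 : 0 < eps ^ 3 / 64) by (apply Rdiv_lt_0_compat; [apply pow_lt, cond_pos|lra]).
destruct (D (mkposreal _ E3)) as [N HN]. exists N. intros n Hn. specialize (HN n Hn).
simpl in HN. rewrite Rminus_0_r in *. apply Rabs_def2 in HN.
generalize (level_step G F n (y n) B). intros H.
destruct (Rlt_dec (Rabs (iterate F (S n) (y n) - iterate F n (y n))) eps) as [K|K]; trivial.
exfalso. apply Rnot_lt_le in K.
generalize (pow_incr eps _ 3 (conj (Rlt_le _ _ (cond_pos eps)) K)). simpl in *. lra.
Qed.

Lemma step_shift (G F W : R -> R) (s x : R) :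
  balanced_wells G F -> continuity W -> step F (fun y => W (y + s)) x = step F W (x + s).
Proof.
intros B C. unfold step. replace (x + s - 1) with (x - 1 + s) by ring.
rewrite <- (mean_shift (fun y => F (mean W y))) by now apply (continuity_response G).
apply RInt_ext. intros y _. now rewrite mean_shift.
Qed.

Lemma tame_shift (W : R -> R) (s : R) : tame W -> tame (fun x => W (x + s)).
Proof.
intros T. split.
- intros x y xy. apply (tame_incr _ T). lra.
- intros x y xy. generalize (tame_lip _ T (x + s) (y + s)). lra.
- intros x. apply (tame_bounds _ T).
Qed.

(** * Compactness *)

Definition unbounded (S : nat -> Prop) : Prop := forall m, exists n, (m <= n)%nat /\ S n.

(** Nested infinite index sets: stage [k] keeps the half where [P k] holds if that half is infinite,
    and the other half otherwise. *)
Fixpoint refine (P : nat -> nat -> Prop) (k : nat) : nat -> Prop :=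
  match k with
  | O => fun _ => True
  | S k => fun n => refine P k n /\
      if excluded_middle_informative (unbounded (fun n => refine P k n /\ P k n))
      then P k n else ~ P k n
  end.

Lemma refine_unbounded (P : nat -> nat -> Prop) (k : nat) : unbounded (refine P k).
Proof.
induction k as [|k IH]; simpl.
- intros m. now exists m.
- destruct excluded_middle_informative as [H|H]; trivial.
  (* The half with [P k] has no element from [m0] on, so every later index lies in the other
     half. *)
  apply not_all_ex_not in H. destruct H as [m0 H].
  intros m. destruct (IH (Nat.max m m0)) as [n [Hn Rn]]. exists n. split; [lia|]. split; trivial.
  intros Pn. apply H. exists n. split; [lia|]. now split.
Qed.

Lemma refine_le (P : nat -> nat -> Prop) (j k n : nat) : (j <= k)%nat -> refine P k n -> refine P j n.
Proof. induction 1; trivial. intros [H1 _]. now apply IHle. Qed.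

(** Diagonal choice: [phi n] lies in the n-th refined set, so [P k] is decided from index k + 1
    on. *)
Lemma subsequence_decides (P : nat -> nat -> Prop) :
  exists phi : nat -> nat, (forall n, (phi n < phi (S n))%nat) /\
  forall k, (exists N, forall n, (N <= n)%nat -> P k (phi n)) \/
            (exists N, forall n, (N <= n)%nat -> ~ P k (phi n)).
Proof.
set (pick := fun k m => proj1_sig (constructive_indefinite_description _ (refine_unbounded P k m))).
assert (pickP : forall k m, (m <= pick k m)%nat /\ refine P k (pick k m)).
{ intros k m. unfold pick. now destruct constructive_indefinite_description. }
set (phi := fix phi n := match n with O => pick O O | S n => pick (S n) (S (phi n)) end).
assert (phiP : forall n, refine P n (phi n)) by (intros [|n]; [exact I|apply (pickP (S n))]).
exists phi. split.
- intros n. simpl. destruct (pickP (S n) (S (phi n))) as [H _]. simpl in H. lia.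
- intros k. assert (H : forall n, (S k <= n)%nat -> refine P (S k) (phi n)).
  { intros n Hn. apply refine_le with n; trivial. }
  simpl in H. destruct excluded_middle_informative as [D|D]; [left|right];
    exists (S k); intros n Hn; apply H; trivial.
Qed.

(** An enumeration with repetitions of the rationals, obtained from Cantor pairing. *)
Definition rational (k : nat) : R :=
  let (a, bc) := of_nat k in let (b, c) := of_nat bc in (INR a - INR b) / (INR c + 1).

Lemma rational_dense (x y : R) : x < y -> exists k, x < rational k < y.
Proof.
intros xy. destruct (archimed_cor1 (y - x)) as [c [Hc c0]]; [lra|].
destruct c as [|c]; [lia|]. clear c0. rewrite S_INR in Hc. assert (Hp := pos_INR c).
set (z := up (x * (INR c + 1))). destruct (archimed (x * (INR c + 1))) as [A1 A2]. fold z in A1, A2.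
(* [Z.to_nat] truncates at zero, so the two numerators are the positive and negative parts of
   [z]. *)
exists (to_nat (Z.to_nat z, to_nat (Z.to_nat (- z), c))).
unfold rational. rewrite !cancel_of_to. rewrite !INR_IZR_INZ, <- minus_IZR.
replace (Z.of_nat (Z.to_nat z) - Z.of_nat (Z.to_nat (- z)))%Z with z by lia.
rewrite <- INR_IZR_INZ. split.
- apply Rmult_lt_reg_r with (INR c + 1); [lra|]. unfold Rdiv. rewrite Rmult_assoc, Rinv_l; lra.
- apply Rle_lt_trans with (x + / (INR c + 1)); [|lra].
  apply Rmult_le_reg_r with (INR c + 1); [lra|]. unfold Rdiv.
  rewrite Rmult_plus_distr_r, Rmult_assoc, Rinv_l; lra.
Qed.

(** Helly selection: along the subsequence every comparison of a value at a rational point with a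
    rational number is eventually decided, which forces the limsup at each point to be a limit. *)
Lemma tame_compactness (V : nat -> R -> R) :
  (forall n, tame (V n)) ->
  exists (phi : nat -> nat) (L : R -> R), (forall n, (phi n < phi (S n))%nat) /\ tame L /\
    forall x, is_lim_seq (fun n => V (phi n) x) (L x).
Proof.
intros T.
destruct (subsequence_decides
  (fun k n => V n (rational (fst (of_nat k))) < rational (snd (of_nat k)))) as [phi [Hphi HP]].
assert (Cut : forall i j, (exists N, forall n, (N <= n)%nat -> V (phi n) (rational i) < rational j) \/
  (exists N, forall n, (N <= n)%nat -> rational j <= V (phi n) (rational i))).
{ intros i j. specialize (HP (to_nat (i, j))). rewrite cancel_of_to in HP. simpl in HP.
  destruct HP as [H|[N H]]; [now left|right]. exists N. intros n Hn. specialize (H n Hn). lra. }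
assert (Ex : forall x, exists l : R, is_lim_seq (fun n => V (phi n) x) l).
{ intros x. destruct (ex_LimSup_seq (fun n => V (phi n) x)) as [[l| |] H]; simpl in H.
  - exists l. apply is_lim_seq_spec. intros eps. destruct eps as [e e0]; simpl.
    destruct (H (mkposreal e e0)) as [_ [N1 H1]]. simpl in H1.
    assert (e4 : 0 < e / 4) by lra. destruct (H (mkposreal _ e4)) as [H2 _]. simpl in H2.
    (* By monotonicity the values at the [i]-th rational exceed l - e/4 infinitely often, hence
       eventually stay above the [j]-th one. Going back to [x] costs at most 2 * e/8, which leaves
       more than l - e. *)
    destruct (rational_dense x (x + e / 8)) as [i Hi]; [lra|].
    destruct (rational_dense (l - e / 2) (l - e / 4)) as [j Hj]; [lra|].
    destruct (Cut i j) as [[N H3]|[N H3]].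
    + exfalso. destruct (H2 N) as [n [Hn Hl]]. specialize (H3 n Hn).
      generalize (tame_incr _ (T (phi n)) x (rational i)). lra.
    + exists (Nat.max N N1). intros n Hn. specialize (H3 n ltac:(lia)). specialize (H1 n ltac:(lia)).
      generalize (tame_lip _ (T (phi n)) x (rational i)). intros. apply Rabs_def1; lra.
  - exfalso. destruct (H 1 O) as [n [_ Hn]]. generalize (tame_bounds _ (T (phi n)) x). lra.
  - exfalso. destruct (H (-1)) as [N HN]. generalize (HN N (le_n N)) (tame_bounds _ (T (phi N)) x). lra. }
exists phi, (fun x => real (Lim_seq (fun n => V (phi n) x))).
assert (HL : forall x, is_lim_seq (fun n => V (phi n) x) (real (Lim_seq (fun n => V (phi n) x)))).
{ intros x. destruct (Ex x) as [l Hl]. now rewrite (is_lim_seq_unique _ _ Hl). }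
repeat split; trivial.
- intros x y xy.
  apply (is_lim_seq_le _ _ (Finite _) (Finite _) (fun n => tame_incr _ (T (phi n)) x y xy) (HL x) (HL y)).
- intros x y xy.
  apply (is_lim_seq_le _ _ (Finite _) (Finite _) (fun n => tame_lip _ (T (phi n)) x y xy)
    (is_lim_seq_minus' _ _ _ _ (HL y) (HL x)) (is_lim_seq_const _)).
- apply (is_lim_seq_le _ _ (Finite _) (Finite _) (fun n => proj1 (tame_bounds _ (T (phi n)) x))
    (is_lim_seq_const _) (HL x)).
- apply (is_lim_seq_le _ _ (Finite _) (Finite _) (fun n => proj2 (tame_bounds _ (T (phi n)) x))
    (HL x) (is_lim_seq_const _)).
Qed.

(* Control [f n] on a finite grid and interpolate by monotonicity. *)
Lemma nondecreasing_uniform_lim (f : nat -> R -> R) (g : R -> R) (a b : R) (eps : posreal) :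
  (forall n, nondecreasing (f n)) -> nondecreasing g -> continuity g ->
  (forall x, is_lim_seq (fun n => f n x) (g x)) -> a <= b ->
  exists N, forall n, (N <= n)%nat -> forall x, a <= x <= b -> Rabs (f n x - g x) < eps.
Proof.
intros If Ig Cg H ab.
destruct (Heine_cor2 (f := g) (a := a) (b := b) (fun x _ => Cg x) (pos_div_2 eps)) as [d Hd].
simpl in Hd. assert (E := cond_pos eps). assert (D := cond_pos d).
assert (P : forall x, exists N, forall n, (N <= n)%nat -> Rabs (f n x - g x) < eps / 2).
{ intros x. specialize (H x). apply is_lim_seq_spec in H. apply (H (pos_div_2 eps)). }
assert (K : forall k, exists N, forall n, (N <= n)%nat ->
  forall x, a <= x <= b -> x <= a + INR k * (d / 2) -> Rabs (f n x - g x) < eps).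
{ induction k as [|k [N IH]].
  - destruct (P a) as [N HN]. exists N. intros n Hn x Hx Hx'. simpl in Hx'.
    replace x with a by lra. specialize (HN n Hn). lra.
  (* Neighbouring grid points, cut off at [b]; the spacing d/2 keeps them strictly within the
     modulus [d] of uniform continuity. *)
  - set (p := Rmin b (a + INR k * (d / 2))). set (q := Rmin b (a + INR (S k) * (d / 2))).
    destruct (P p) as [N1 H1]. destruct (P q) as [N2 H2].
    exists (Nat.max N (Nat.max N1 N2)). intros n Hn x Hx Hx'.
    specialize (IH n ltac:(lia)). specialize (H1 n ltac:(lia)). specialize (H2 n ltac:(lia)).
    destruct (Rle_dec x (a + INR k * (d / 2))) as [C|C]; [now apply IH|].
    assert (k0 := pos_INR k).
    assert (0 <= INR k * (d / 2)) by (apply Rmult_le_pos; lra).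
    assert (Sk : INR (S k) * (d / 2) = INR k * (d / 2) + d / 2) by (rewrite S_INR; ring).
    assert (xq : x <= q) by (unfold q; apply Rmin_glb; lra).
    assert (px : p <= x) by (unfold p; apply Rle_trans with (1 := Rmin_r _ _); lra).
    assert (pa : a <= p) by (unfold p; apply Rmin_glb; lra).
    assert (qb : q <= b) by apply Rmin_l.
    assert (qp : q - p <= d / 2).
    { replace p with (a + INR k * (d / 2)). unfold q. generalize (Rmin_r b (a + INR (S k) * (d / 2))). lra.
      unfold p. rewrite Rmin_right; lra. }
    specialize (Hd q p ltac:(lra) ltac:(lra) ltac:(apply Rabs_def1; lra)).
    generalize (If n _ _ xq) (If n _ _ px) (Ig _ _ xq) (Ig _ _ px). intros.
    apply Rabs_def2 in H1. apply Rabs_def2 in H2. apply Rabs_def2 in Hd. apply Rabs_def1; lra. }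
destruct (archimed ((b - a) / (d / 2))) as [A1 _].
assert (0 <= (b - a) / (d / 2)) by (apply Rdiv_le_0_compat; lra).
assert (0 <= up ((b - a) / (d / 2)))%Z by (apply le_IZR; lra).
destruct (K (Z.to_nat (up ((b - a) / (d / 2))))) as [N HN].
exists N. intros n Hn x Hx. apply HN; trivial.
rewrite INR_IZR_INZ, Z2Nat.id by trivial.
apply Rle_trans with (a + (b - a) / (d / 2) * (d / 2)).
- replace ((b - a) / (d / 2) * (d / 2)) with (b - a) by (field; lra). lra.
- apply Rplus_le_compat_l, Rmult_le_compat_r; lra.
Qed.

(** Monotonicity makes the pointwise convergence uniform on the window, so it passes under the
    integral. *)
Lemma mean_lim (f : nat -> R -> R) (g : R -> R) (x : R) :
  (forall n, nondecreasing (f n)) -> (forall n, continuity (f n)) -> nondecreasing g -> continuity g ->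
  (forall x, is_lim_seq (fun n => f n x) (g x)) ->
  is_lim_seq (fun n => mean (f n) x) (mean g x).
Proof.
intros If Cf Ig Cg H. apply is_lim_seq_spec. intros eps.
destruct (nondecreasing_uniform_lim f g x (x + 1) (pos_div_2 eps) If Ig Cg H) as [N HN]; [lra|].
exists N. intros n Hn. rewrite <- mean_minus by trivial.
destruct (mean_bounds (fun y => f n y - g y) x (- (eps / 2)) (eps / 2)).
- now apply (continuity_minus (f n)).
- intros y Hy. specialize (HN n Hn y Hy). simpl in HN. apply Rabs_def2 in HN. lra.
- generalize (cond_pos eps). intros. apply Rabs_def1; lra.
Qed.

Lemma step_lim (G F : R -> R) (V : nat -> R -> R) (L : R -> R) (x : R) :
  balanced_wells G F -> (forall n, tame (V n)) -> tame L ->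
  (forall x, is_lim_seq (fun n => V n x) (L x)) ->
  is_lim_seq (fun n => step F (V n) x) (step F L x).
Proof.
intros B T TL H. unfold step.
apply (mean_lim (fun n y => F (mean (V n) y)) (fun y => F (mean L y))).
- intros n. now apply (response_nondecreasing G).
- intros n. apply (continuity_response G); trivial. now apply tame_continuity.
- now apply (response_nondecreasing G).
- apply (continuity_response G); trivial. now apply tame_continuity.
- intros y. apply is_lim_seq_continuous; [apply (bw_continuity _ _ B)|].
  apply mean_lim; trivial.
  + intros n. apply tame_incr, T.
  + intros n. apply tame_continuity, T.
  + now apply tame_incr.
  + now apply tame_continuity.
Qed.

(* Staying between [m] and [M], away from both wells, costs energy proportional to the length. *)
Lemma plateau_cost (G F : R -> R) (m M C : R) :
  balanced_wells G F -> -1 < m -> m <= M -> M < 1 ->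
  exists Y, 0 < Y /\ forall V p, tame V ->
    (forall a b, a <= b -> RInt (fun x => well G (mean V x)) a b <= C) ->
    m <= V p -> V (p + Y) <= M -> False.
Proof.
intros B Hm mM HM.
destruct (continuity_ab_min (well G) m M mM (fun x _ => continuity_well G F B x)) as [w [Hw wm]].
set (eta := well G w). assert (e0 : 0 < eta) by (apply (bw_well _ _ B); lra).
(* For x up to p + 1 + |C| / eta the window [x, x+1] stays inside the plateau, so the integral is at
   least eta + |C|, which exceeds C. *)
exists (2 + Rabs C / eta).
assert (q0 : 0 <= Rabs C / eta) by (apply Rdiv_le_0_compat; trivial; apply Rabs_pos).
split; [lra|]. intros V p T HC H1 H2.
specialize (HC p (p + 1 + Rabs C / eta) ltac:(lra)).
assert (CV := tame_continuity _ T).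
assert (I : (p + 1 + Rabs C / eta - p) * eta <= RInt (fun x => well G (mean V x)) p (p + 1 + Rabs C / eta)).
{ rewrite <- (RInt_const p (p + 1 + Rabs C / eta) eta : RInt (fun _ => eta) _ _ = (p + 1 + Rabs C / eta - p) * eta).
  apply RInt_le; [lra|apply ex_RInt_const| |].
  - apply continuity_ex_RInt. apply (continuity_comp (mean V) (well G)); [now apply continuity_mean|].
    now apply (continuity_well G F).
  - intros x Hx. apply Hw. apply mean_bounds; trivial. intros y Hy.
    generalize (tame_incr _ T p y ltac:(lra)) (tame_incr _ T y (p + (2 + Rabs C / eta)) ltac:(lra)). lra. }
replace ((p + 1 + Rabs C / eta - p) * eta) with (eta + Rabs C) in I by (field; lra).
generalize (Rle_abs C). lra.
Qed.

(** * Existence of the normalised profile *)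

Lemma heteroclinic_exists (G F : R -> R) :
  balanced_wells G F ->
  exists W, tame W /\ (forall x, W x = step F W x) /\ is_lim W m_infty (-1) /\ is_lim W p_infty 1.
Proof.
intros B.
assert (Zero : forall n, exists x, iterate F n x = 0).
{ intros n. assert (Hn := pos_INR n). destruct (iterate_saturated G F n B) as [SL SR].
  destruct (IVT_gen (iterate F n) (- (INR n + 1)) (INR n + 1) 0) as [x [_ Hx]].
  - apply tame_continuity. exact (iterate_tame G F n B).
  - rewrite SL, SR by lra. rewrite Rmin_left, Rmax_right; lra.
  - now exists x. }
(* Pinning the value 0 at the origin keeps the transition from escaping to infinity in the limit. *)
set (s := fun n => proj1_sig (constructive_indefinite_description _ (Zero n))).
assert (sP : forall n, iterate F n (s n) = 0).
{ intros n. unfold s. now destruct constructive_indefinite_description. }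
set (V := fun n x => iterate F n (x + s n)).
assert (TV : forall n, tame (V n)).
{ intros n. apply (tame_shift (iterate F n)). exact (iterate_tame G F n B). }
assert (EV : forall n a b, a <= b -> RInt (fun x => well G (mean (V n) x)) a b <= level G F 0).
{ intros n a b ab. apply Rle_trans with (2 := level_le_0 G F n B).
  assert (Ci := tame_continuity _ (iterate_tame G F n B)).
  assert (C : continuity (fun x => well G (mean (iterate F n) x))).
  { apply (continuity_comp (mean (iterate F n)) (well G)); [now apply continuity_mean|].
    now apply (continuity_well G F). }
  generalize (well_integral_le G F n (a + s n) (b + s n) B ltac:(lra)).
  rewrite <- (RInt_shift _ a b (s n) C). intros H. apply Rle_trans with (2 := H). right.
  apply RInt_ext. intros x _. unfold V. now rewrite mean_shift. }
destruct (tame_compactness V TV) as (phi & L & Hphi & TL & HL).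
assert (phi_inf : filterlim phi eventually eventually).
{ now apply eventually_subseq. }
exists L. split; trivial. split; [|split].
- intros x.
  assert (H1 := step_lim G F _ L x B (fun n => TV (phi n)) TL HL).
  (* [step] commutes with translations, so this is an increment of the iteration at the moving point
     x + s n. *)
  assert (H2 : is_lim_seq (fun n => step F (V (phi n)) x - V (phi n) x) 0).
  { apply (is_lim_seq_subseq (fun n => step F (V n) x - V n x)); trivial.
    apply is_lim_seq_ext with (2 := iterate_increment_lim G F (fun n => x + s n) B).
    intros n. unfold V. rewrite (step_shift G); trivial. apply tame_continuity. exact (iterate_tame G F n B). }
  assert (H3 := is_lim_seq_minus' _ _ _ _ H1 (HL x)).
  apply is_lim_seq_unique in H2. apply is_lim_seq_unique in H3. rewrite H2 in H3.
  injection H3. lra.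
- apply is_lim_spec. intros eps.
  assert (e0 := cond_pos eps).
  (* Capping at 1 keeps -1 + e/2 below the upper value 0 of the plateau. *)
  set (e := Rmin eps 1). assert (e1 : 0 < e <= 1) by (unfold e, Rmin; destruct Rle_dec; lra).
  assert (ee : e <= eps) by apply Rmin_l.
  destruct (plateau_cost G F (-1 + e / 2) 0 (level G F 0) B) as (Y & Y0 & HY); try lra.
  exists (- Y). intros x Hx.
  assert (L (- Y) < -1 + eps).
  (* Otherwise some translated iterate is at least -1 + e/2 at [- Y] and equals 0 at the origin: a
     plateau of length [Y], too costly. *)
  { apply Rnot_le_lt. intros K.
    assert (HLs := HL (- Y)). apply is_lim_seq_spec in HLs.
    assert (e2 : 0 < e / 2) by lra. destruct (HLs (mkposreal _ e2)) as [N HN].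
    specialize (HN N (le_n N)). simpl in HN. apply Rabs_def2 in HN.
    apply (HY (V (phi N)) (- Y) (TV _) (EV _)); [lra|].
    unfold V. replace (- Y + Y + s (phi N)) with (s (phi N)) by ring. rewrite sP. lra. }
  generalize (tame_incr _ TL x (- Y) ltac:(lra)) (tame_bounds _ TL x). intros. apply Rabs_def1; lra.
- apply is_lim_spec. intros eps.
  assert (e0 := cond_pos eps).
  set (e := Rmin eps 1). assert (e1 : 0 < e <= 1) by (unfold e, Rmin; destruct Rle_dec; lra).
  assert (ee : e <= eps) by apply Rmin_l.
  destruct (plateau_cost G F 0 (1 - e / 2) (level G F 0) B) as (Y & Y0 & HY); try lra.
  exists Y. intros x Hx.
  assert (1 - eps < L Y).
  { apply Rnot_le_lt. intros K.
    assert (HLs := HL Y). apply is_lim_seq_spec in HLs.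
    assert (e2 : 0 < e / 2) by lra. destruct (HLs (mkposreal _ e2)) as [N HN].
    specialize (HN N (le_n N)). simpl in HN. apply Rabs_def2 in HN.
    apply (HY (V (phi N)) 0 (TV _) (EV _)).
    - unfold V. rewrite Rplus_0_l, sP. lra.
    - rewrite Rplus_0_l. lra. }
  generalize (tame_incr _ TL Y x ltac:(lra)) (tame_bounds _ TL x). intros. apply Rabs_def1; lra.
Qed.

(** * Normalisation *)

(** By convexity the difference quotients of [f] along the segment from [a] to [b] are at most f(b)
    - f(a); the derivative is their limit as t tends to 0. *)
Lemma convex_tangent (f : R -> R) (a b : R) :
  convex_fun f -> ex_derive f a -> f a + Derive f a * (b - a) <= f b.
Proof.
intros Hc Hd.
assert (D : is_derive (fun t => f (a + t * (b - a))) 0 (Derive f a * (b - a))).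
{ auto_derive; [|ring_simplify (a + 0 * (b - a))].
  - now replace (a + 0 * (b - a)) with a by ring.
  - change (Derive (fun x => f x)) with (Derive f). ring. }
apply is_derive_Reals in D.
apply le_epsilon. intros eps He. destruct (D eps He) as [d Hd'].
set (t := Rmin 1 (d / 2)). assert (d0 := cond_pos d).
assert (t0 : 0 < t <= 1) by (unfold t, Rmin; destruct Rle_dec; lra).
assert (td : t < d) by (generalize (Rmin_r 1 (d / 2)); fold t; lra).
specialize (Hd' t ltac:(lra) ltac:(apply Rabs_def1; lra)).
rewrite Rplus_0_l in Hd'. replace (a + 0 * (b - a)) with a in Hd' by ring.
apply Rabs_def2 in Hd'.
generalize (Hc b a t ltac:(lra)). replace (t * b + (1 - t) * a) with (a + t * (b - a)) by ring. intros C.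
assert ((f (a + t * (b - a)) - f a) / t <= f b - f a).
{ apply Rmult_le_reg_r with t; [lra|]. unfold Rdiv. rewrite Rmult_assoc, Rinv_l; lra. }
lra.
Qed.

Lemma normalised_balanced_wells (Phi : R -> R) (sigma rm vm rp vp : R) :
  smooth Phi -> convex_fun Phi -> conservative_shock Phi sigma rm vm rp vp ->
  rp <> rm -> sigma <> 0 ->
  (forall w : R, -1 < w < 1 -> g_area Phi rm vm rp vp w > 0) ->
  balanced_wells (Phi_hat Phi rm vm rp vp)
    (fun w => 2 / (Derive Phi rp - Derive Phi rm) *
      (Derive Phi ((rp + rm) / 2 + (rp - rm) / 2 * w) - (Derive Phi rp + Derive Phi rm) / 2)).
Proof.
intros S Hc (J1 & J2 & J3) nr ns Hg. unfold jump in J1, J2, J3.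
assert (dPhi : forall x, ex_derive Phi x) by apply (S 0%nat).
assert (cP : continuity (Derive Phi)).
{ apply (is_derive_continuity _ (Derive (Derive Phi))). intros x. apply Derive_correct, (S 1%nat). }
assert (JP : Derive Phi rp - Derive Phi rm = sigma ^ 2 * (rp - rm)) by nra.
assert (nP : Derive Phi rp - Derive Phi rm <> 0).
{ rewrite JP. apply Rmult_integral_contrapositive. split; [now apply pow_nonzero|lra]. }
(* The product of the two jumps is (sigma [[r]])^2, so the rescaling preserves convexity. *)
assert (pos : 0 < 4 / ((Derive Phi rp - Derive Phi rm) * (rp - rm))).
{ apply Rdiv_lt_0_compat; [lra|]. rewrite JP.
  replace (sigma ^ 2 * (rp - rm) * (rp - rm)) with ((sigma * (rp - rm)) ^ 2) by ring.
  apply pow2_gt_0. apply Rmult_integral_contrapositive. split; lra. }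
set (F := fun w => 2 / (Derive Phi rp - Derive Phi rm) *
      (Derive Phi ((rp + rm) / 2 + (rp - rm) / 2 * w) - (Derive Phi rp + Derive Phi rm) / 2)).
assert (DG : forall w, is_derive (Phi_hat Phi rm vm rp vp) w (F w)).
{ intros w. unfold Phi_hat, jump, avg. auto_derive; [apply dPhi|].
  change (Derive (fun x => Phi x)) with (Derive Phi). unfold F. field. split; lra. }
assert (CF : continuity F).
{ unfold F. intros w. assert (C := cP ((rp + rm) / 2 + (rp - rm) / 2 * w)).
  assert (C' : continuity_pt (fun w => Derive Phi ((rp + rm) / 2 + (rp - rm) / 2 * w)) w).
  { apply (continuity_pt_comp (fun w => (rp + rm) / 2 + (rp - rm) / 2 * w) (Derive Phi)); trivial. reg. }
  apply (continuity_pt_scal (fun w => Derive Phi ((rp + rm) / 2 + (rp - rm) / 2 * w) - _)).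
  apply continuity_pt_minus; trivial. apply continuity_pt_const. now intros ? ?. }
assert (P1 : (rp + rm) / 2 + (rp - rm) / 2 * 1 = rp) by field.
assert (Pm1 : (rp + rm) / 2 + (rp - rm) / 2 * (-1) = rm) by field.
split; trivial.
- intros a b.
  generalize (convex_tangent Phi ((rp + rm) / 2 + (rp - rm) / 2 * a) ((rp + rm) / 2 + (rp - rm) / 2 * b) Hc (dPhi _)).
  intros H. apply (Rmult_le_compat_l _ _ _ (Rlt_le _ _ pos)) in H.
  unfold F, Phi_hat, jump, avg.
  set (A := Phi ((rp + rm) / 2 + (rp - rm) / 2 * a)) in *.
  set (D := Derive Phi ((rp + rm) / 2 + (rp - rm) / 2 * a)) in *.
  set (E := Phi ((rp + rm) / 2 + (rp - rm) / 2 * b)) in *.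
  replace (4 / ((Derive Phi rp - Derive Phi rm) * (rp - rm)) *
    (A + D * ((rp + rm) / 2 + (rp - rm) / 2 * b - ((rp + rm) / 2 + (rp - rm) / 2 * a))))
    with (4 / ((Derive Phi rp - Derive Phi rm) * (rp - rm)) * A
      + 2 / (Derive Phi rp - Derive Phi rm) * D * (b - a)) in H by (field; lra).
  replace (2 * ((Derive Phi rp + Derive Phi rm) / 2) / (Derive Phi rp - Derive Phi rm) * b)
    with (2 * ((Derive Phi rp + Derive Phi rm) / 2) / (Derive Phi rp - Derive Phi rm) * a
      + 2 / (Derive Phi rp - Derive Phi rm) * ((Derive Phi rp + Derive Phi rm) / 2) * (b - a)) by (field; lra).
  lra.
- unfold F. rewrite Pm1. field. lra.
- unfold F. rewrite P1. field. lra.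
(* Eliminating the velocity jump from the energy condition leaves the jump of Phi as the average of
   Phi' times the jump of r, which says that the wells are balanced. *)
- assert (K : Phi rp - Phi rm = (Derive Phi rp + Derive Phi rm) / 2 * (rp - rm)).
  { apply Rmult_eq_reg_l with sigma; trivial. nra. }
  unfold Phi_hat, jump, avg. rewrite P1, Pm1.
  replace (Phi rp) with (Phi rm + (Derive Phi rp + Derive Phi rm) / 2 * (rp - rm)) by lra.
  field. lra.
- intros w Hw. generalize (Hg w Hw). unfold g_area, well.
  rewrite (RInt_ext _ (fun u => u - F u)).
  + rewrite (RInt_fundamental (fun u => u ^ 2 / 2 - Phi_hat Phi rm vm rp vp u)).
    * lra.
    * intros u. apply (is_derive_minus (fun u => u ^ 2 / 2) (Phi_hat Phi rm vm rp vp)); trivial.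
      auto_derive; trivial. field.
    * apply (continuity_minus (fun u => u)); trivial. intros u; reg.
  + intros u _. now rewrite (is_derive_unique _ _ _ (DG u)).
Qed.

(** * From the normalised profile back to the front *)

Lemma affine_monotone (f : R -> R) (c d : R) :
  nondecreasing f -> monotone (fun x => c + d * f x).
Proof.
intros I. destruct (Rle_dec 0 d); [left|right]; intros x y xy; specialize (I x y xy); nra.
Qed.

Lemma affine_bounded (f : R -> R) (c d : R) :
  (forall x, -1 <= f x <= 1) -> bounded_fun (fun x => c + d * f x).
Proof.
intros H. exists (Rabs c + Rabs d). intros x.
apply Rle_trans with (1 := Rabs_triang _ _). rewrite Rabs_mult.
assert (Rabs (f x) <= 1) by (apply Rabs_le, H). generalize (Rabs_pos d). nra.
Qed.

Lemma affine_is_derive (f : R -> R) (c d x l : R) :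
  is_derive f x l -> is_derive (fun x => c + d * f x) x (d * l).
Proof.
intros D. rewrite <- (Rplus_0_l (d * l)).
apply (is_derive_plus (fun _ => c) (fun x => d * f x)).
- apply (is_derive_const c).
- now apply is_derive_scal.
Qed.

Lemma affine_C1 (f df : R -> R) (c d : R) :
  (forall x, is_derive f x (df x)) -> continuity df -> Defs.C1 (fun x => c + d * f x).
Proof.
intros D C x. split.
- exists (d * df x). now apply affine_is_derive.
- apply (continuous_ext (fun y => d * df y)).
  + intros y. symmetry. now apply is_derive_unique, affine_is_derive.
  + apply continuity_continuous. now apply (continuity_scal df).
Qed.

Lemma affine_is_lim (f : R -> R) (c d l : R) (x : Rbar) :
  is_lim f x l -> is_lim (fun x => c + d * f x) x (c + d * l).
Proof.
intros H. apply (is_lim_plus' (fun _ => c)); [apply is_lim_const|].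
apply (is_lim_scal_l f d x l H).
Qed.

Theorem theorem1p1 (Phi : R -> R) (Hsm : smooth Phi) (Hcv : convex_fun Phi) :
  (forall (sigma rm vm rp vp : R) (RR VV : R -> R),
      front Phi sigma rm vm rp vp RR VV ->
      conservative_shock Phi sigma rm vm rp vp)
  /\
  (forall (sigma rm vm rp vp : R),
      (rm, vm) <> (rp, vp) ->
      conservative_shock Phi sigma rm vm rp vp ->
      Rabs sigma > sqrt (Derive_n Phi 2 rm) ->
      Rabs sigma > sqrt (Derive_n Phi 2 rp) ->
      (forall w : R, -1 < w < 1 -> g_area Phi rm vm rp vp w > 0) ->
      exists RR VV : R -> R,
        front Phi sigma rm vm rp vp RR VV /\ monotone RR /\ monotone VV).
Proof.
split; [intros; now apply (front_jump_conditions Phi sigma rm vm rp vp RR VV)|].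
intros sigma rm vm rp vp Hne Hsh Hs1 _ Hg.
assert (ns : sigma <> 0).
{ intros ->. rewrite Rabs_R0 in Hs1. generalize (sqrt_pos (Derive_n Phi 2 rm)). lra. }
assert (J := Hsh). destruct J as (J1 & J2 & _). unfold jump in J1, J2.
assert (nr : rp <> rm).
{ intros ->. apply Hne. f_equal. lra. }
assert (JP : Derive Phi rp - Derive Phi rm = sigma ^ 2 * (rp - rm)) by nra.
assert (nP : Derive Phi rp - Derive Phi rm <> 0).
{ rewrite JP. apply Rmult_integral_contrapositive. split; [now apply pow_nonzero|lra]. }
assert (B := normalised_balanced_wells Phi sigma rm vm rp vp Hsm Hcv Hsh nr ns Hg).
set (F := fun w => 2 / (Derive Phi rp - Derive Phi rm) *
      (Derive Phi ((rp + rm) / 2 + (rp - rm) / 2 * w) - (Derive Phi rp + Derive Phi rm) / 2)) in B.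
destruct (heteroclinic_exists _ F B) as (W & T & HW & Lm & Lp).
assert (CW := tame_continuity _ T). assert (CF := continuity_response _ F W B CW).
assert (DA := fun x => is_derive_mean W x CW).
(* The fixed point equation upgrades [W] from Lipschitz to differentiable. *)
assert (DW : forall x : R, is_derive W x (F (mean W x) - F (mean W (x - 1)))).
{ intros x. apply (is_derive_ext (step F W)); [intros; symmetry; apply HW|].
  assert (D := is_derive_mean _ (x - 1) CF). unfold step.
  replace (F (mean W x)) with (F (mean W (x - 1 + 1))) by (do 2 f_equal; ring).
  rewrite <- (Rmult_1_l (_ - _)).
  apply (is_derive_comp (mean (fun y => F (mean W y))) (fun y => y - 1)); trivial.
  auto_derive; trivial. }
assert (FP : forall w, Derive Phi ((rp + rm) / 2 + (rp - rm) / 2 * w) =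
  (Derive Phi rp + Derive Phi rm) / 2 + (Derive Phi rp - Derive Phi rm) / 2 * F w).
{ intros w. unfold F. field. lra. }
assert (CDA : continuity (fun x => W (x + 1) - W x)).
{ apply (continuity_minus (fun x => W (x + 1))); trivial. now apply continuity_shift. }
assert (CDW : continuity (fun x => F (mean W x) - F (mean W (x - 1)))).
{ apply (continuity_minus (fun x => F (mean W x))); trivial.
  now apply (continuity_shift (fun x => F (mean W x))). }
(* R rescales the averaged profile and V the profile itself: the first equation is then the
   derivative of [mean W], the second that of the fixed point equation. *)
exists (fun x => (rp + rm) / 2 + (rp - rm) / 2 * mean W x), (fun x => (vp + vm) / 2 + (vp - vm) / 2 * W x).
split; [|split].
- repeat match goal with |- front _ _ _ _ _ _ _ _ => unfold front | |- _ /\ _ => split end.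
  + now apply (affine_C1 _ (fun x => W (x + 1) - W x)).
  + now apply (affine_C1 _ (fun x => F (mean W x) - F (mean W (x - 1)))).
  + apply affine_bounded. intros x. now apply mean_tame_bounds.
  + apply affine_bounded, T.
  + replace (Finite rm) with (Finite ((rp + rm) / 2 + (rp - rm) / 2 * (-1))) by (f_equal; field).
    apply affine_is_lim. now apply (is_lim_mean W false).
  + replace (Finite rp) with (Finite ((rp + rm) / 2 + (rp - rm) / 2 * 1)) by (f_equal; field).
    apply affine_is_lim. now apply (is_lim_mean W true).
  + replace (Finite vm) with (Finite ((vp + vm) / 2 + (vp - vm) / 2 * (-1))) by (f_equal; field). now apply affine_is_lim.
  + replace (Finite vp) with (Finite ((vp + vm) / 2 + (vp - vm) / 2 * 1)) by (f_equal; field). now apply affine_is_lim.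
  + intros x. rewrite (is_derive_unique _ _ _ (affine_is_derive _ _ _ _ _ (DA x))).
    replace (vp - vm) with (- sigma * (rp - rm)) by lra. field.
  + intros x. rewrite (is_derive_unique _ _ _ (affine_is_derive _ _ _ _ _ (DW x))), !FP.
    replace (vp - vm) with (- sigma * (rp - rm)) by lra. rewrite JP. field.
- apply affine_monotone. apply mean_nondecreasing; trivial. apply T.
- apply affine_monotone. apply T.
Qed.
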